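(* Fix $\beta\ge0$. Let $\{(u_n,v_n)\}_{n\ge1}$ be a sequence in $H^1\times H^1$ such that (i) $K[u_n,v_n]<0$ for each $n$; (ii) $K[u_n,v_n]\to0$ as $n\to\infty$. If $\|(u_n,v_n)\|_{H^1\times H^1}\neq0$ for each $n$, then $$\liminf_{n\to\infty}J[u_n,v_n]\ge d.$$
   Context: Functions are real valued on $\mathbb{R}^3$; $H^1=H^1(\mathbb{R}^3)$ with $\|f\|_{H^1}^2=\int_{\mathbb{R}^3}(|\nabla f|^2+f^2)\,dx$ and $\|(f,g)\|_{H^1\times H^1}^2=\|f\|_{H^1}^2+\|g\|_{H^1}^2$. For $(\phi,\psi)\in H^1\times H^1$ define $$J[\phi,\psi]=\frac12\left(\|\phi\|_{H^1}^2+\|\psi\|_{H^1}^2\right)-\frac14\int_{\mathbb{R}^3}\left[\phi^4+\psi^4+2\beta\phi^2\psi^2\right]dx,$$ $$K[\phi,\psi]=\|\phi\|_{H^1}^2+\|\psi\|_{H^1}^2-\int_{\mathbb{R}^3}\left[\phi^4+\psi^4+2\beta\phi^2\psi^2\right]dx,$$ and $d:=\min\{J[\phi,\psi] : (\phi,\psi)\in H^1\times H^1,\ (\phi,\psi)\neq(0,0),\ K[\phi,\psi]=0\}$. For $\beta\ge0$ it is known (Sirakov) that this minimum is attained and strictly positive. *)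

(* Defs.v *)
From mathcomp Require Import all_boot all_order all_algebra.
From mathcomp Require Import all_classical all_reals all_analysis.

Set Implicit Arguments.
Unset Strict Implicit.
Unset Printing Implicit Defensive.

Import Order.TTheory GRing.Theory Num.Theory.
Import numFieldNormedType.Exports.

Local Open Scope classical_set_scope.
Local Open Scope ring_scope.

(* R^3 carries its topology as R3 and its Borel sigma-algebra as R3b: the
   library keeps the two structures on R on convertible copies of the type. *)
Definition R3 (R : realType) : normedModType R := (R * R * R)%type.

Definition R3b (R : realType) : measurableType _ :=
  (measurableTypeR R * measurableTypeR R * measurableTypeR R)%type.

Section SobolevSpace.
Variable R : realType.

Definition leb3 : {measure set (R3b R) -> \bar R} :=
  (@lebesgue_measure R \x @lebesgue_measure R \x @lebesgue_measure R)%E.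

Definition basis3 (i : 'I_3) : R3 R :=
  ((i == 0 :> nat)%:R, (i == 1 :> nat)%:R, (i == 2 :> nat)%:R).

Definition partial (i : 'I_3) (f : R3 R -> R) : R3 R -> R := 'D_(basis3 i) f.

(* C^oo: every iterated partial derivative is (Frechet) differentiable. *)
Definition smooth (f : R3 R -> R) : Prop :=
  forall (s : seq 'I_3) (x : R3 R), differentiable (foldr partial f s) x.

Definition test_function (f : R3 R -> R) : Prop :=
  smooth f /\ compact (closure [set x | f x != 0]).

Definition weak_partial (i : 'I_3) (f g : R3b R -> R) : Prop :=
  forall t : R3 R -> R, test_function t ->
    \int[leb3]_x (f x * partial i t x) = - \int[leb3]_x (g x * t x).

(* An element of H^1(R^3), given by representatives of the function and of its
   weak gradient. The gradient is determined almost everywhere by the function,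
   and everything below depends on both only up to a.e. equality. *)
Record H1 := MkH1 {
  H1fun :> R3b R -> R;
  H1grad : 'I_3 -> R3b R -> R;
  H1fun_L2 : H1fun \in Lfun leb3 2%:E;
  H1grad_L2 : forall i, H1grad i \in Lfun leb3 2%:E;
  H1grad_weak : forall i, weak_partial i H1fun (H1grad i) }.

Definition H1norm (f : H1) : R :=
  Num.sqrt (\int[leb3]_x ((\sum_(i < 3) H1grad f i x ^+ 2) + f x ^+ 2)).

Definition H1pair_norm (f g : H1) : R :=
  Num.sqrt (H1norm f ^+ 2 + H1norm g ^+ 2).

(* (f, g) = (0, 0) in H^1 x H^1, i.e. as classes modulo a.e. equality. *)
Definition H1pair_zero (f g : H1) : Prop :=
  {ae leb3, forall x, f x = 0 /\ g x = 0}.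

(* The integral is the real-valued one; it is finite because of the embedding
   of H^1(R^3) into L^4(R^3). *)
Definition quartic (beta : R) (f g : H1) : R :=
  \int[leb3]_x (f x ^+ 4 + g x ^+ 4 + 2 * beta * f x ^+ 2 * g x ^+ 2).

Definition J (beta : R) (f g : H1) : R :=
  2^-1 * (H1norm f ^+ 2 + H1norm g ^+ 2) - 4^-1 * quartic beta f g.

Definition K (beta : R) (f g : H1) : R :=
  H1norm f ^+ 2 + H1norm g ^+ 2 - quartic beta f g.

(* The level d. For 0 <= beta the infimum is attained (Sirakov), hence equal
   to the minimum of J over the nonzero pairs with K = 0. *)
Definition ground_level (beta : R) : R :=
  inf [set r | exists f g : H1,
    [/\ ~ H1pair_zero f g, K beta f g = 0 & r = J beta f g]].

End SobolevSpace.

(* Main.v *)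
Require Import Defs.
From mathcomp Require Import all_boot all_order all_algebra.
From mathcomp Require Import all_classical all_reals all_analysis.
From mathcomp Require Import measurable_realfun ring lra.
Import Order.TTheory GRing.Theory Num.Theory.
Import numFieldNormedType.Exports.
Local Open Scope classical_set_scope.
Local Open Scope ring_scope.

Set Implicit Arguments.
Unset Strict Implicit.

(** The proof is a one-dimensional scaling argument. Write N for the squared
    norm of a pair and Q for its quartic term, so that J = N / 2 - Q / 4 and
    K = N - Q. If K < 0 then 0 <= N < Q, and N > 0 for a nonzero norm. Moving
    the pair along its ray to (l u, l v) changes N into l ^ 2 N and Q into
    l ^ 4 Q, so l ^ 2 = N / Q makes K vanish; the scaled pair is admissible in
    the definition of the ground level d, where J equals N / 4. Hence
    d <= l ^ 2 N / 4 <= N / 4, as l ^ 2 < 1. Since J = N / 4 + K / 4 for every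
    pair, this reads J >= d + K / 4 (lemma [ground_level_le_J]), and letting K
    tend to 0 gives the bound on the limit inferior.

    What remains is that N and Q are homogeneous and that a scaled weak gradient
    is again a weak gradient. All three follow from the homogeneity of the
    real-valued integral under positive factors (lemma [Rintegral_scale]), which
    holds for every function: the supremum over simple functions scales, and
    where the extended integral is infinite both sides are 0. *)

Section IntegralScaling.
Context d (T : measurableType d) (R : realType).
Variable mu : {measure set T -> \bar R}.
Import HBNNSimple.

(** Multiplication by c maps the simple functions below f to simple functions
    below c f. Applied to c and to its inverse, this bound gives the equality
    that follows. *)
Lemma ge0_integral_scale_ge (c : R) (f : T -> \bar R) : 0 < c ->
  (forall x, 0 <= f x)%E ->
  (c%:E * \int[mu]_x f x <= \int[mu]_x (c%:E * f x))%E.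
Proof.
move=> c0 f0; have c0' := ltW c0.
have cf0 x : (0 <= c%:E * f x)%E by rewrite mule_ge0 ?lee_fin.
rewrite !ge0_integralTE// -ereal_sup_pZl//.
apply: ereal_sup_le => _ [_ [h /= hf <-] <-].
exists (scale_nnsfun h c0'); last by rewrite -sintegralrM.
by move=> x /=; rewrite EFinM lee_pmul2l// lte_fin.
Qed.

Lemma ge0_integral_scale (c : R) (f : T -> \bar R) : 0 < c ->
  (forall x, 0 <= f x)%E ->
  (\int[mu]_x (c%:E * f x) = c%:E * \int[mu]_x f x)%E.
Proof.
move=> c0 f0; apply/eqP; rewrite eq_le ge0_integral_scale_ge// andbT.
have cf0 x : (0 <= c%:E * f x)%E by rewrite mule_ge0 ?lee_fin// ltW.
have ci0 : 0 < c^-1 by rewrite invr_gt0.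
have := ge0_integral_scale_ge ci0 cf0.
under [X in (_ <= X)%E -> _]eq_integral do
  rewrite muleA -EFinM mulVf ?gt_eqF// mul1e.
by rewrite muleC lee_pdivrMr// muleC.
Qed.

Lemma integral_scale (c : R) (f : T -> \bar R) : 0 < c ->
  (\int[mu]_x (c%:E * f x) = c%:E * \int[mu]_x f x)%E.
Proof.
move=> c0; have c0' := ltW c0.
rewrite integralE ge0_funeposM// ge0_funenegM// !ge0_integral_scale//.
(* Finite positive factors distribute even over +oo - +oo, which is -oo. *)
rewrite [in RHS]integralE.
case: (integral _ _ f^\+)%E => [a| |]; case: (integral _ _ f^\-)%E => [b| |];
  by rewrite -?EFinB -?EFinM ?mulrBr /= ?gt0_muley ?gt0_muleNy ?lte_fin.
Qed.

Lemma Rintegral_scale (c : R) (f : T -> R) : 0 < c ->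
  \int[mu]_x (c * f x) = c * \int[mu]_x f x.
Proof.
move=> c0; rewrite /Rintegral.
under eq_integral do rewrite EFinM.
rewrite integral_scale//; case: (integral _ _ _) => [r//| |] /=.
  by rewrite gt0_muley ?lte_fin// mulr0.
by rewrite gt0_muleNy ?lte_fin// mulr0.
Qed.

End IntegralScaling.

Section H1Scaling.
Variable R : realType.
Implicit Types f g : H1 R.

Section Scale.
Variables (c : R) (c0 : 0 < c) (f : H1 R).

Let scale_fun_L2 : (c \o* f) \in Lfun (leb3 R) 2%:E.
Proof. by apply: Lfun_scale; [rewrite ler1n|exact: H1fun_L2]. Qed.

Let scale_grad_L2 i : (c \o* H1grad f i) \in Lfun (leb3 R) 2%:E.
Proof. by apply: Lfun_scale; [rewrite ler1n|exact: H1grad_L2]. Qed.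

Let scale_weak i : weak_partial i (c \o* f) (c \o* H1grad f i).
Proof.
move=> t tt /=.
under eq_Rintegral do rewrite mulrAC mulrC.
rewrite Rintegral_scale// (H1grad_weak f i tt) mulrN -Rintegral_scale//.
by congr (- _); apply: eq_Rintegral => x _; rewrite mulrAC mulrC.
Qed.

Definition H1scale : H1 R := MkH1 scale_fun_L2 scale_grad_L2 scale_weak.

End Scale.

Lemma H1norm_sq f : H1norm f ^+ 2 =
  \int[leb3 R]_x ((\sum_(i < 3) H1grad f i x ^+ 2) + f x ^+ 2).
Proof.
rewrite sqr_sqrtr// Rintegral_ge0// => x _.
by rewrite addr_ge0 ?sqr_ge0// sumr_ge0// => i _; rewrite sqr_ge0.
Qed.

Lemma H1norm_scale c (c0 : 0 < c) f :
  H1norm (H1scale c0 f) ^+ 2 = c ^+ 2 * H1norm f ^+ 2.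
Proof.
rewrite !H1norm_sq -Rintegral_scale ?exprn_gt0//.
apply: eq_Rintegral => x _ /=.
rewrite mulrDr mulr_sumr exprMn mulrC; congr (_ + _).
by apply: eq_bigr => i _; rewrite exprMn mulrC.
Qed.

Lemma quartic_scale beta c (c0 : 0 < c) f g :
  quartic beta (H1scale c0 f) (H1scale c0 g) = c ^+ 4 * quartic beta f g.
Proof.
rewrite /quartic -Rintegral_scale ?exprn_gt0//.
by apply: eq_Rintegral => x _ /=; ring.
Qed.

(** A positive quartic term certifies that a pair is nonzero. *)
Lemma quartic_zero beta f g : H1pair_zero f g -> quartic beta f g = 0.
Proof.
move=> fg0; rewrite /quartic /Rintegral.
have mH (h : H1 R) : measurable_fun setT (h : R3b R -> R).
  by have := H1fun_L2 h; rewrite inE => /andP[]; rewrite inE.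
rewrite (ae_eq_integral (cst 0%E)) ?integral0//.
- apply/measurable_EFinP; apply: measurable_funD; first apply: measurable_funD.
  + exact: measurable_funX.
  + exact: measurable_funX.
  + by apply: measurable_funM; [apply: measurable_funM => //|];
      exact: measurable_funX.
- apply: filterS fg0 => x [-> ->] _ /=.
  by congr EFin; ring.
Qed.

Lemma J_on_nehari beta f g : K beta f g = 0 ->
  J beta f g = 4^-1 * (H1norm f ^+ 2 + H1norm g ^+ 2).
Proof. by rewrite /K /J => K0; lra. Qed.

(** The infimum defining d is over a set bounded below by 0, so that it is a
    genuine lower bound of the set. *)
Lemma ground_level_le beta f g : ~ H1pair_zero f g -> K beta f g = 0 ->
  ground_level beta <= J beta f g.
Proof.
move=> fg0 K0; apply: ge_inf; last by exists f, g.
exists 0 => _ [f' [g' [_ /J_on_nehari J' ->]]].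
by rewrite J' mulr_ge0// addr_ge0 ?sqr_ge0.
Qed.

(** The competitor for d is the point c (f, g) of the ray through the pair at
    which K vanishes; since K < 0 at (f, g) itself, c < 1, and the quarter of
    the squared norm, which is J at the competitor, decreases along the way. *)
Lemma ground_level_le_J beta f g : K beta f g < 0 -> H1pair_norm f g != 0 ->
  ground_level beta + 4^-1 * K beta f g <= J beta f g.
Proof.
rewrite /H1pair_norm => Kneg nz.
set N := H1norm f ^+ 2 + H1norm g ^+ 2 in nz.
set Q := quartic beta f g.
have NQ : N < Q by move: Kneg; rewrite /K subr_lt0.
have N0 : 0 < N.
  rewrite lt_neqAle addr_ge0 ?sqr_ge0// andbT.
  by apply: contraNneq nz => <-; rewrite sqrtr0.
have Q0 : 0 < Q := lt_trans N0 NQ.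
pose c := Num.sqrt (N / Q).
have c0 : 0 < c by rewrite sqrtr_gt0 divr_gt0.
have c2 : c ^+ 2 = N / Q by rewrite sqr_sqrtr// ltW// divr_gt0.
have Ns : H1norm (H1scale c0 f) ^+ 2 + H1norm (H1scale c0 g) ^+ 2 = c ^+ 2 * N.
  by rewrite !H1norm_scale -mulrDr.
have Ks : K beta (H1scale c0 f) (H1scale c0 g) = 0.
  rewrite /K Ns quartic_scale -/Q (exprM c 2 2) c2.
  by field; rewrite gt_eqF.
have nzs : ~ H1pair_zero (H1scale c0 f) (H1scale c0 g).
  move=> /(quartic_zero beta); rewrite quartic_scale => /eqP.
  by rewrite mulf_eq0 expf_eq0/= !gt_eqF.
have := ground_level_le nzs Ks; rewrite (J_on_nehari Ks) Ns => dle.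
have : c ^+ 2 * N <= N.
  by rewrite ler_piMl ?(ltW N0)// c2 ler_pdivrMr// mul1r ltW.
rewrite /J /K -/N -/Q => cN; lra.
Qed.

End H1Scaling.

Lemma le_limn_einf (R : realType) (a b : (\bar R)^nat) :
  (forall n, a n <= b n)%E -> (limn_einf a <= limn_einf b)%E.
Proof.
move=> ab; rewrite !limn_einf_lim.
apply: lee_lim; [exact: is_cvg_einfs|exact: is_cvg_einfs|].
apply: nearW => n; apply: le_ereal_inf_tmp => _ [k nk <-].
by apply: le_trans (ab k); apply: ereal_inf_lbound; exists k.
Qed.

Unset Implicit Arguments.
Set Strict Implicit.

Theorem corollary1p13 (R : realType) (beta : R) (hbeta : 0 <= beta)
    (u v : nat -> H1 R)
    (hKneg : forall n : nat, K beta (u n) (v n) < 0)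
    (hK0 : K beta (u n) (v n) @[n --> \oo] --> (0 : R))
    (hnorm : forall n : nat, H1pair_norm (u n) (v n) != 0) :
  ((ground_level beta)%:E <= limn_einf (fun n => (J beta (u n) (v n))%:E))%E.
Proof.
pose b n := ((ground_level beta + 4^-1 * K beta (u n) (v n))%:E : \bar R).
have b_cvg : b n @[n --> \oo] --> ((ground_level beta)%:E : \bar R).
  apply: cvg_EFin; first exact: nearW.
  rewrite -[X in _ --> X]addr0; apply: cvgD; first exact: cvg_cst.
  by rewrite -[X in _ --> X](mulr0 4^-1); apply: cvgMr.
rewrite -(cvg_limn_einf_sup b_cvg).1; apply: le_limn_einf => n.
by rewrite lee_fin; exact: ground_level_le_J.
Qed.
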